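(* Let $k$ be an algebraically closed field of characteristic $p$, $t$ transcendental over $k$, $d\ge2$, $N\ge1$ with $(d,p)\neq(2,2)$. If $f(x)\in H(d,N,k)$, then $\operatorname{Gal}(f^N(x)-t/k(t))\cong[S_d]^N$.
   Context: $H(d,N,k)$ is the set of polynomials $f\in k[x]$ of degree exactly $d$ such that: (1) $f'(x)$ is separable if $p\neq2$, and $f'(x)$ is the square of a separable polynomial if $p=2$; (2) if $w_1,\dots,w_r$ are the distinct critical points (zeros of $f'$) of $f$, then $f^n(w_i)\neq f^m(w_j)$ for all $1\le i,j\le r$ and all integers $0\le m,n\le N$, unless $m=n$ and $i=j$; (3) if $p=2$: for all $b,c\in k$, $(x-b)^3\nmid f(x)-c$; (4) if $p\mid d$: $f$ is indecomposable in $k[x]$ and $\deg f'=d-2$. $f^N$ is $N$-fold composition; $\operatorname{Gal}(f^N(x)-t/k(t))$ is the Galois group of the splitting field of $f^N(x)-t$ over $k(t)$. $[S_d]^N$ is the $N$-th wreath power of $S_d$ ($[S_d]^1=S_d$, $[S_d]^n=[S_d]^{n-1}[S_d]$, with $G[H]$ acting on pairs by $(i,r)\mapsto(\pi(i),\tau_i(r))$), i.e. the automorphism group of the $d$-ary rooted tree to level $N$. *)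

(* Defs.v *)
From HB Require Import structures.
From mathcomp Require Import all_boot all_order all_algebra all_fingroup all_field.
Set Implicit Arguments. Unset Strict Implicit. Unset Printing Implicit Defensive.
Import Order.TTheory GRing.Theory Num.Theory.
Local Open Scope ring_scope.

Fixpoint leaves (d n : nat) : finType :=
  if n is n'.+1 then (leaves d n' * 'I_d)%type else unit.

(* [S_d]^n : [S_d]^0 trivial, [S_d]^(n+1) = [S_d]^n [S_d], where an element of
   G[H] is a permutation (i, r) |-> (pi i, tau_i r) with pi in G, tau_i in H = S_d. *)
Fixpoint wreath_pow (d n : nat) : {set {perm leaves d n}} :=
  match n as n0 return {set {perm leaves d n0}} with
  | 0 => [set: {perm leaves d 0}]
  | n'.+1 =>
    [set s : {perm leaves d n'.+1} |
      [exists pi in wreath_pow d n',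
        exists tau : {ffun leaves d n' -> {perm 'I_d}},
          [forall x : leaves d n'.+1, s x == (pi x.1, tau x.1 x.2)]]]
  end.

Definition poly_iter (R : nzRingType) (f : {poly R}) (n : nat) : {poly R} :=
  iter n (fun g => f \Po g) 'X.

Definition indecomposable (R : nzRingType) (f : {poly R}) : Prop :=
  forall g h : {poly R}, f = g \Po h -> (size g <= 2)%N \/ (size h <= 2)%N.

Definition H_set (k : fieldType) (d N : nat) (f : {poly k}) : Prop :=
  [/\ size f = d.+1,
      (~ (2%N \in [pchar k]) -> separable_poly f^`()) /\
      (2%N \in [pchar k] -> exists g : {poly k}, separable_poly g /\ f^`() = g ^+ 2),
      (forall (w w' : k) (m n : nat), root f^`() w -> root f^`() w' ->
         (n <= N)%N -> (m <= N)%N ->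
         iter n (fun x => f.[x]) w = iter m (fun x => f.[x]) w' ->
         n = m /\ w = w'),
      (2%N \in [pchar k] -> forall b c : k, ~~ ((('X - b%:P) ^+ 3) %| (f - c%:P)))
    &
      (forall p : nat, p \in [pchar k] -> (p %| d)%N ->
         indecomposable f /\ size f^`() = d.-1)].

Definition ratfun (k : fieldType) := {fraction {poly k}}.
Definition const_rf (k : fieldType) (c : k) : ratfun k := tofrac (c%:P).
Definition t_rf (k : fieldType) : ratfun k := tofrac ('X : {poly k}).

Definition iter_minus_t (k : fieldType) (f : {poly k}) (N : nat) : {poly ratfun k} :=
  map_poly (@const_rf k) (poly_iter f N) - (t_rf k)%:P.

(* Main.v *)
(* Let G be the Galois group of f^N - t, acting on the roots of f^n = t for each
   n <= N; these form the first N levels of a d-ary tree, so that G is a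
   subgroup of [S_d]^N, and it is enough to find in G, for every n < N, the
   transposition of any two roots of f^(n+1) = t with the same image under f.
   - Some transposition.  Let w be a critical point.  By H(d,N,k), f^(n+1)
     takes the value f^(n+1)(w) at w with multiplicity exactly 2 and elsewhere
     with multiplicity 1.  A homomorphism to k from the ring generated by the
     roots x of f^(n+1) = t, sending t to f^(n+1)(w), thus identifies exactly
     two roots, and its inertia group is generated by their transposition; as
     d >= 2, they have the same image under f.
   - All of them.  The roots x' such that the transposition (x x') lies in G
     form a class C(x) in the fiber of x.  The product of the elements of C(x)
     is fixed by the stabilizer of x and integral over k[x], hence equal to
     h(x) for a polynomial h; multiplying over the fiber of y = f(x) and
     comparing the degrees in y shows that deg h = #|C(x)|.  As h is constant
     on C(x), f is a polynomial in h.  But f is indecomposable, by hypothesis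
     if p divides d.  Otherwise, if f = g o h, take a root u of g'; all the
     roots of h - u are critical points of f with the same image, hence there
     is only one, of multiplicity at least 3 as a root of f', which is
     impossible.  So C(x) is the whole fiber. *)
Require Import Defs.
From HB Require Import structures.
From mathcomp Require Import all_boot all_order all_algebra all_fingroup all_field.
From mathcomp Require Import zify.
From Stdlib Require Import Classical ClassicalEpsilon.
Set Implicit Arguments. Unset Strict Implicit. Unset Printing Implicit Defensive.
Import GRing.Theory.
Local Open Scope ring_scope.

(** * Specialization of integral extensions *)

Section LyingOver.

Variables (L : fieldType) (k : closedFieldType).

Lemma mulmx_horner_mx (n : nat) (A : 'M[L]_n.+1) (v : 'rV_n.+1) (x : L) h :
  v *m A = x *: v -> v *m horner_mx A h = h.[x] *: v.
Proof.
move=> vA; elim/poly_ind: h => [|p c IHp].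
  by rewrite rmorph0 mulmx0 horner0 scale0r.
rewrite rmorphD rmorphM /= horner_mx_X horner_mx_C mulmxDr mulmxA IHp.
by rewrite -scalemxAl vA mul_mx_scalar hornerMXaddC scalerDl scalerA.
Qed.

(* Nakayama's lemma by determinants: [h] evaluated at the companion matrix of
   [g] is singular over [L], whereas it specializes to an invertible matrix as
   soon as [h] specializes to a nonzero constant. *)
Lemma size_specialized_relation (R : comNzRingType)
    (iota : {rmorphism R -> L}) (phi : {rmorphism R -> k}) (x : L)
    (g h : {poly R}) :
  (forall r, iota r = 0 -> phi r = 0) -> g \is monic ->
  root (map_poly iota g) x -> root (map_poly iota h) x ->
  size (map_poly phi h) != 1%N.
Proof.
move=> ker_phi g_monic gx hx; apply/negP => /size_poly1P[c c_neq0 hc].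
have size_g : (1 < size (map_poly iota g))%N.
  by apply: root_size_gt1 gx; apply/monic_neq0/monic_map.
have [n [A Ag]] : exists n (A : 'M[R]_n.+1), char_poly A = g.
  have := companionmxK g_monic.
  move: size_g; rewrite size_map_poly_id0; last first.
    by rewrite (monicP g_monic) rmorph1 oner_neq0.
  move: (companionmx g); case: (size g) => [|[|n]] // A _ Ag.
  by exists n, A.
have : eigenvalue (map_mx iota A) x.
  by rewrite eigenvalue_root_char -map_char_poly Ag.
case/eigenvalueP=> v vA v_neq0.
have det0 : iota (\det (horner_mx A h)) = 0.
  rewrite -det_map_mx map_horner_mx; apply/eqP/det0P; exists v => //.
  by rewrite (mulmx_horner_mx _ vA) (rootP hx) scale0r.
move/ker_phi: det0; rewrite -det_map_mx map_horner_mx hc horner_mx_C.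
by rewrite det_scalar; apply/eqP; rewrite expf_neq0.
Qed.

(** Among the relations [h] of [x] with nonzero image under [phi], one whose image has least size
    divides the images of all others: the quotient lifts along [s], so the remainder is again the
    image of a relation. This image is not constant by the preceding lemma, hence has a root [a]. *)
Lemma specialize_root (R : comNzRingType) (s : {rmorphism k -> R})
    (iota : {rmorphism R -> L}) (phi : {rmorphism R -> k}) (x : L)
    (g : {poly R}) :
  cancel s phi -> (forall r, iota r = 0 -> phi r = 0) -> g \is monic ->
  root (map_poly iota g) x ->
  exists a, forall h, root (map_poly iota h) x -> root (map_poly phi h) a.
Proof.
move=> sK ker_phi g_monic gx.
suff main n : forall h, (size (map_poly phi h) < n)%N -> map_poly phi h != 0 ->
    root (map_poly iota h) x ->
    exists a, forall h, root (map_poly iota h) x -> root (map_poly phi h) a.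
  by apply: (main _ g (leqnn _)) gx; apply/monic_neq0/monic_map.
elim: n => // n IHn h size_h h_neq0 hx.
have [[h' [h'x h'Nd]]|hd] := classic (exists h', root (map_poly iota h') x /\
    ~~ (map_poly phi h %| map_poly phi h')).
  pose q := map_poly s (map_poly phi h' %/ map_poly phi h).
  have phiE : map_poly phi (h' - q * h) = map_poly phi h' %% map_poly phi h.
    rewrite rmorphB rmorphM /= {1}(divp_eq (map_poly phi h') (map_poly phi h)).
    have -> : map_poly phi q = map_poly phi h' %/ map_poly phi h.
      by apply/polyP => i; rewrite !coef_map /= sK.
    by rewrite addrAC subrr add0r.
  apply: (IHn (h' - q * h)).
  - by rewrite -ltnS phiE (leq_ltn_trans _ size_h) // ltn_modp.
  - by rewrite phiE.
  by rewrite rmorphB rmorphM rootE !hornerE (rootP hx) (rootP h'x) mulr0 subr0.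
have [a ha] := closed_rootP _ (size_specialized_relation ker_phi g_monic gx hx).
exists a => h' h'x; apply: root_dvdp ha.
by apply: contraT => h'Nd; case: hd; exists h'.
Qed.

(* [sp b a] reads: [b] lies in the ring generated by [k], [x] and [xs], and the
   homomorphism from this ring to [k] maps [b] to [a]. *)
Definition specialization (kap : k -> L) (x : L) (w : k) (xs : seq L)
    (sp : L -> k -> Prop) :=
  [/\ forall b a a', sp b a -> sp b a' -> a = a',
      forall c, sp (kap c) c,
      forall b a b' a', sp b a -> sp b' a' -> sp (b + b') (a + a') /\
                                              sp (b * b') (a * a'),
      sp x w
    & forall z, z \in xs -> exists a, sp z a].

Variable kap : {rmorphism k -> L}.

Definition transc (x : L) :=
  forall Q : {poly k}, (map_poly kap Q).[x] = 0 -> Q = 0.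

(** The elements of [xs] are adjoined to [k[x]] one at a time, each integral by the monic
    [F1 - F1(x)]. [R] is an iterated polynomial ring mapping to both [L] and [k]; the inclusion of
    kernels stands in for a homomorphism to [k] from a subring of [L]. *)
Lemma exists_specialization (F : {poly k}) (x : L) (w : k) (xs : seq L) :
  (1 < size F)%N -> transc x ->
  {in xs, forall z, (map_poly kap F).[z] = (map_poly kap F).[x]} ->
  exists sp, specialization kap x w xs sp.
Proof.
move=> size_F x_transc xsF.
suff [R [s [iota [phi [sK iotas ker_phi [r [rx rw]] xsP]]]]] :
  exists (R : comNzRingType) (s : {rmorphism k -> R})
         (iota : {rmorphism R -> L}) (phi : {rmorphism R -> k}),
  [/\ cancel s phi, iota \o s =1 kap, forall r, iota r = 0 -> phi r = 0,
      exists r, iota r = x /\ phi r = w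
    & forall z, z \in xs -> exists r, iota r = z].
  exists (fun b a => exists r, iota r = b /\ phi r = a); split.
  - move=> b a a' [u [<- <-]] [v [uv <-]].
    apply/eqP; rewrite -subr_eq0 -rmorphB; apply/eqP/ker_phi.
    by rewrite rmorphB uv subrr.
  - by move=> c; exists (s c); rewrite sK -iotas.
  - move=> _ _ _ _ [u [<- <-]] [v [<- <-]]; split.
      by exists (u + v); rewrite !rmorphD.
    by exists (u * v); rewrite !rmorphM.
  - by exists r.
  by move=> z /xsP[u <-]; exists (phi u), u.
elim: xs xsF => [_|z xs IHxs xsF].
  have cx : commr_rmorph kap x by move=> y; apply: mulrC.
  have cw : commr_rmorph (idfun : {rmorphism k -> k}) w.
    by move=> y; apply: mulrC.
  exists {poly k}, polyC, (horner_morph cx), (horner_morph cw); split=> //.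
  - by move=> c; rewrite /= horner_morphC.
  - by move=> c; rewrite /= horner_morphC.
  - by move=> Q /x_transc ->; rewrite rmorph0.
  by exists 'X; rewrite /= !horner_morphX.
have [|R [s [iota [phi [sK iotas ker_phi [r [rx rw]] xsP]]]]] := IHxs.
  by move=> y y_xs; apply: xsF; rewrite inE y_xs orbT.
have lF_neq0 : lead_coef F != 0 by rewrite lead_coef_eq0 -size_poly_gt0 ltnW.
pose F1 := (lead_coef F)^-1 *: F.
have F1_monic : F1 \is monic.
  by rewrite monicE lead_coefZ mulVf.
have size_F1 : size F1 = size F by rewrite size_scale ?invr_eq0.
pose g := map_poly s F1 - ((map_poly s F1).[r])%:P.
have size_sF1 : size (map_poly s F1) = size F.
  rewrite size_map_poly_id0 ?size_F1 //.
  by rewrite (monicP F1_monic) rmorph1 oner_neq0.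
have g_monic : g \is monic.
  rewrite monicE lead_coefDl ?size_polyN ?size_sF1.
    by rewrite -monicE monic_map.
  by rewrite (leq_ltn_trans (size_polyC_leq1 _)).
have iF1 : map_poly iota (map_poly s F1) = map_poly kap F1.
  by rewrite -map_poly_comp; apply: eq_map_poly => y; rewrite -iotas.
have gz : root (map_poly iota g) z.
  rewrite rootE rmorphB /= map_polyC /= -horner_map rx iF1 !hornerE.
  by rewrite map_polyZ !hornerZ (xsF z) ?mem_head // subrr.
have [a aP] := specialize_root sK ker_phi g_monic gz.
have cz : commr_rmorph iota z by move=> y; apply: mulrC.
have ca : commr_rmorph phi a by move=> y; apply: mulrC.
exists {poly R}, (polyC \o s), (horner_morph cz), (horner_morph ca); split.
- by move=> c; rewrite /= horner_morphC.
- by move=> c; rewrite /= horner_morphC -iotas.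
- by move=> h /rootP/aP/rootP.
- by exists r%:P; rewrite /= !horner_morphC.
move=> y; rewrite inE => /predU1P[->|/xsP[u <-]].
  by exists 'X; rewrite /= horner_morphX.
by exists u%:P; rewrite /= horner_morphC.
Qed.

End LyingOver.

(** * Iterates and the set H(d,N,k) *)

Section Polynomials.

Variable k : fieldType.
Implicit Types (f p q : {poly k}) (w x : k).

Lemma dvdp_deriv_exp p w (m : nat) :
  ('X - w%:P) ^+ m.+1 %| p -> ('X - w%:P) ^+ m %| p^`().
Proof.
case/dvdpP=> q ->; rewrite derivM deriv_exp derivXsubC mul1r /= dvdp_add //.
  by rewrite exprS mulrA dvdp_mull.
by rewrite -mulr_natr mulrCA dvdp_mulr.
Qed.

Lemma separable_poly_sqr_root p w :
  separable_poly p -> ~~ (('X - w%:P) ^+ 2 %| p).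
Proof.
move=> p_sep; apply/negP => /dvdpP[q def_p]; move: p_sep.
rewrite def_p exprS expr1 mulrA separable_root rootM root_XsubC eqxx.
by rewrite orbT andbF.
Qed.

Lemma separable_sqr_cube_root p w :
  separable_poly p -> ~~ (('X - w%:P) ^+ 3 %| p ^+ 2).
Proof.
move=> p_sep; apply/negP => w3.
have pw: root p w.
  have : root (p ^+ 2) w by rewrite -dvdp_XsubCl (dvdp_trans _ w3) ?dvdp_exp.
  by rewrite expr2 rootM orbb.
move: pw p_sep w3; rewrite -dvdp_XsubCl => /dvdpP[q ->].
rewrite separable_root exprMn => /andP[_ qNw].
rewrite (dvdp_exp_sub _ 3 2) ?polyXsubC_eq0 //=.
by rewrite expr1 dvdp_XsubCl expr2 rootM orbb (negPf qNw).
Qed.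

Lemma poly_iterD f m n : poly_iter f (m + n) = poly_iter f m \Po poly_iter f n.
Proof.
elim: m => [|m IHm]; first by rewrite comp_polyX.
by rewrite -[LHS]/(f \Po poly_iter f (m + n)) IHm comp_polyA.
Qed.

Lemma poly_iterSr f n : poly_iter f n.+1 = poly_iter f n \Po f.
Proof.
by rewrite -addn1 poly_iterD -[poly_iter f 1]/(f \Po 'X) comp_polyXr.
Qed.

Lemma horner_poly_iter f n x : (poly_iter f n).[x] = iter n (horner f) x.
Proof. by elim: n => [|n IHn]; rewrite ?hornerX //= horner_comp IHn. Qed.

Lemma size_poly_iter f d n :
  (0 < d)%N -> size f = d.+1 -> size (poly_iter f n) = (d ^ n).+1.
Proof.
move=> d_gt0 size_f; rewrite -[LHS]prednK.
  congr _.+1; elim: n => [|n IHn]; first by rewrite size_polyX.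
  by rewrite /= size_comp_poly IHn size_f expnS.
rewrite lt0n size_poly_eq0; elim: n => [|n IHn]; first by rewrite polyX_eq0.
by rewrite poly_iterSr comp_poly_eq0 // size_f.
Qed.

Lemma root_deriv_poly_iter f n x :
  root (poly_iter f n)^`() x ->
  exists2 i, (i < n)%N & root f^`() (iter i (horner f) x).
Proof.
elim: n => [|n IHn] /=; first by rewrite derivX rootC oner_eq0.
rewrite deriv_comp rootM => /orP[|/IHn[i lt_in fi]]; last first.
  by exists i => //; apply: ltnW.
by rewrite rootE horner_comp horner_poly_iter => fn; exists n.
Qed.

Lemma deriv_poly_iter_neq0 f n :
  (1 < size f)%N -> f^`() != 0 -> (poly_iter f n)^`() != 0.
Proof.
move=> size_f f'_neq0; elim: n => [|n IHn]; first by rewrite derivX oner_eq0.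
by rewrite poly_iterSr deriv_comp mulf_neq0 ?comp_poly_eq0.
Qed.

Lemma deriv_poly_iter_root f n w :
  (0 < n)%N -> root f^`() w -> root (poly_iter f n)^`() w.
Proof.
case: n => // n _ fw; rewrite poly_iterSr deriv_comp rootM fw orbT //.
Qed.

End Polynomials.

(** * Critical points and indecomposability for members of [H_set] *)

Section HSet.

Variables (k : closedFieldType) (d N : nat) (f : {poly k}).
Hypotheses (d_ge2 : (2 <= d)%N) (N_ge1 : (1 <= N)%N).
Hypothesis d2_p2 : ~ (d = 2%N /\ 2%N \in [pchar k]).
Hypothesis fH : H_set d N f.

Let size_f : size f = d.+1. Proof. by case: fH. Qed.

Lemma H_set_le n : (n <= N)%N -> H_set d n f.
Proof.
case: fH => ? ? crit ? ? le_nN; split=> // w w' m1 m2 w_crit w'_crit le1 le2.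
by apply: crit => //; apply: leq_trans le_nN.
Qed.

(** A bound valid in every characteristic: the zeros of [f'] are simple if [p <> 2] and double if
    [p = 2]. *)
Lemma H_set_deriv_cube w : ~~ (('X - w%:P) ^+ 3 %| f^`()).
Proof.
case: fH => _ [sep sep2] _ _ _.
have [/sep2[g [g_sep ->]]|/negP/sep f_sep] := boolP (2%N \in [pchar k]).
  exact: separable_sqr_cube_root.
apply: contra (separable_poly_sqr_root w f_sep) => /(dvdp_trans _)-> //.
exact: dvdp_exp2l.
Qed.

Lemma H_set_deriv_neq0 : f^`() != 0.
Proof. by apply: contraNneq (H_set_deriv_cube 0) => ->; rewrite dvdp0. Qed.

(** If [p <> 2], a triple zero of [f - c] would be a double zero of the separable [f']; if [p = 2],
    this is a defining condition. *)
Lemma H_set_cube w c : ~~ (('X - w%:P) ^+ 3 %| f - c%:P).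
Proof.
case: fH => _ [sep _] _ cube _.
have [/cube->//|/negP/sep f_sep] := boolP (2%N \in [pchar k]).
apply: contra (separable_poly_sqr_root w f_sep) => /dvdp_deriv_exp.
by rewrite derivB derivC subr0.
Qed.

(** If [f'] were a nonzero constant, then [p] would divide [d], as the coefficient of [f'] of index
    [d - 1] is [d] times the leading one of [f]; the condition [deg f' = d - 2] then gives [d = 2]
    and [p = 2], the excluded case. *)
Lemma H_set_crit : exists w, root f^`() w.
Proof.
apply/closed_rootP; apply: contra_not_neq d2_p2 => size_f'.
have d_eq0 : d%:R = 0 :> k.
  apply: contra_eq size_f' => d_neq0.
  have : f^`()`_d.-1 != 0.
    rewrite coef_deriv prednK 1?ltnW // -mulr_natr mulf_neq0 //.
    rewrite -[d]/(d.+1.-1) -size_f -lead_coefE lead_coef_eq0.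
    by rewrite -size_poly_eq0 size_f.
  apply: contraNneq => size_f'1; rewrite nth_default // size_f'1.
  by case: d d_ge2 d_neq0.
have [|p p_char] := @natf0_pchar k d (ltnW d_ge2); first exact/eqP.
case: fH => _ _ _ _ /(_ p p_char).
rewrite (dvdn_pcharf p_char) d_eq0 eqxx size_f' => /(_ isT)[_ d_pred].
have d2 : d = 2%N by case: d d_ge2 d_pred => [|[|[|]]].
split=> //; suff <- : p = 2%N by [].
have : (p %| 2)%N by rewrite (dvdn_pcharf p_char) -d2 d_eq0.
by rewrite dvdn_prime2 ?(pcharf_prime p_char) // => /eqP.
Qed.

Lemma H_set_post_crit w w' i n :
  root f^`() w -> root f^`() w' -> (i <= N)%N -> (n <= N)%N ->
  iter i (horner f) w = iter n (horner f) w' -> i = n /\ w = w'.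
Proof. by case: fH => _ _ crit _ _ *; apply: crit. Qed.

(** Some [f^i(v)] with [i < N] is critical for [f], and [f^(N-i)] maps it to [f^N(w)]; the
    separation of critical orbits forces [N - i = N]. *)
Lemma H_set_iter_crit w v :
  root f^`() w -> root (poly_iter f N)^`() v ->
  iter N (horner f) v = iter N (horner f) w -> v = w.
Proof.
move=> w_crit /root_deriv_poly_iter[i lt_iN vi_crit].
rewrite -{1}(subnK (ltnW lt_iN)) iterD => eqN.
have [eqi <-] := H_set_post_crit vi_crit w_crit (leq_subr i N) (leqnn N) eqN.
by have := subKn (ltnW lt_iN); rewrite eqi subnn => <-.
Qed.

(** With [v = f(w)], the quotient of [f^N - f^N(w)] by [f - v] is [q \Po f]. It does not vanish at
    [w]: otherwise [v] would be critical for [f^(N-1)], and some forward image [f^(i+1)(w)] would be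
    critical for [f]. So the multiplicity is that of [f - v]. *)
Lemma H_set_iter_cube w :
  root f^`() w ->
  ~~ (('X - w%:P) ^+ 3 %| poly_iter f N - (iter N (horner f) w)%:P).
Proof.
move=> w_crit; rewrite -(prednK N_ge1) iterSr poly_iterSr; set n := N.-1.
set v := f.[w]; set Fn := poly_iter f n.
have : root (Fn - (iter n (horner f) v)%:P) v.
  by rewrite rootE !hornerE horner_poly_iter subrr.
case/factor_theorem=> q def_q.
have -> : Fn \Po f - (iter n (horner f) v)%:P = (q \Po f) * (f - v%:P).
  by rewrite -(comp_polyC (iter _ _ _) f) -comp_polyB def_q comp_polyM
             comp_polyB comp_polyX comp_polyC.
have qNv : ~~ root q v.
  apply: contraL w_crit => qv.
  have : root Fn^`() v.
    have : ('X - v%:P) ^+ 2 %| Fn - (iter n (horner f) v)%:P.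
      by rewrite def_q exprS expr1 dvdp_mul2r ?polyXsubC_eq0 // dvdp_XsubCl.
    by move/dvdp_deriv_exp; rewrite derivB derivC subr0 expr1 dvdp_XsubCl.
  case/root_deriv_poly_iter => i lt_in vi_crit; apply/negP => w_crit.
  rewrite /v -iterSr in vi_crit.
  have [|//] := H_set_post_crit vi_crit w_crit (leq0n N) _
    (erefl (iter i.+1 _ w)).
  by rewrite -(prednK N_ge1) ltnS ltnW.
rewrite Gauss_dvdpr ?H_set_cube //.
rewrite coprimep_pexpl // coprimep_sym coprimep_XsubC.
by rewrite rootE horner_comp.
Qed.

Lemma H_set_indecomposable : indecomposable f.
Proof.
have [d_eq0|d_neq0] := eqVneq (d%:R : k) 0.
  have [|p p_char] := @natf0_pchar k d (ltnW d_ge2); first exact/eqP.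
  case: fH => _ _ _ _ /(_ p p_char); rewrite (dvdn_pcharf p_char) d_eq0 eqxx.
  by case.
move=> g h def_f; apply/orP; rewrite -[_ || _]negbK negb_or -!ltnNge.
apply/negP=> /andP[size_g size_h].
have def_d : d = ((size g).-1 * (size h).-1)%N.
  by rewrite -size_comp_poly -def_f size_f.
have [u gu] : exists u, root g^`() u.
  apply/closed_rootP.
  have : g^`()`_(size g).-2 != 0.
    rewrite coef_deriv prednK ?ltn_predRL 1?ltnW // -mulr_natr mulf_neq0 //.
      by rewrite -lead_coefE lead_coef_eq0 -size_poly_gt0 2?ltnW.
    by apply: contraNneq d_neq0 => g0; rewrite def_d natrM g0 mul0r.
  apply: contraNneq => size_g'; rewrite nth_default // size_g'.
  by case: (size g) size_g => [|[|[|]]].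
have hu_size : size (h - u%:P) = size h.
  rewrite size_polyDl // size_polyN.
  by rewrite (leq_ltn_trans (size_polyC_leq1 _)) // ltnW.
have [w hw] : exists w, root (h - u%:P) w.
  by apply/closed_rootP; rewrite hu_size; case: (size h) size_h => [|[|]].
have f'E : f^`() = (g^`() \Po h) * h^`() by rewrite def_f deriv_comp.
have fiber x : root (h - u%:P) x -> root f^`() x /\ f.[x] = g.[u].
  rewrite rootE !hornerE subr_eq0 => /eqP hx; split.
    by rewrite f'E rootM rootE horner_comp hx (rootP gu) eqxx.
  by rewrite def_f horner_comp hx.
have [w_crit fw] := fiber w hw.
have hw_uniq x : root (h - u%:P) x -> x = w.
  move=> /fiber[x_crit fx].
  case: (@H_set_post_crit x w 1 1 x_crit w_crit N_ge1 N_ge1) => //.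
  by rewrite /= fx fw.
(* Having [w] as its only root, [h - u] is a constant times a power of [X - w] with exponent at
   least 2; it divides [g' \Po h], and [X - w] divides [h']. *)
have [r def_h] := closed_field_poly_normal (h - u%:P).
have hu_neq0 : h - u%:P != 0 by rewrite -size_poly_gt0 hu_size 2?ltnW.
have size_r : size h = (size r).+1.
  by rewrite -hu_size def_h size_scale ?lead_coef_eq0 // size_prod_XsubC.
have r_nseq : r = nseq (size r) w.
  apply/all_pred1P/allP=> x x_r; apply/eqP/hw_uniq.
  by rewrite def_h rootZ ?lead_coef_eq0 // root_prod_XsubC.
have w2_h : ('X - w%:P) ^+ 2 %| h - u%:P.
  rewrite def_h dvdpZr ?lead_coef_eq0 // r_nseq big_nseq.
  rewrite (_ : iter _ _ _ = ('X - w%:P) ^+ size r); last first.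
    by elim: (size r) => //= n ->; rewrite exprS.
  by apply: dvdp_exp2l; rewrite -ltnS -size_r.
apply/negP: (H_set_deriv_cube w); rewrite negbK f'E exprSr dvdp_mul //.
  apply: dvdp_trans w2_h _.
  have := dvdp_comp_poly h; rewrite -dvdp_XsubCl in gu => /(_ _ _ gu).
  by rewrite comp_polyB comp_polyX comp_polyC.
by have := dvdp_deriv_exp w2_h; rewrite derivB derivC subr0 expr1.
Qed.

End HSet.

(** * Polynomials and permutations *)

Lemma poly_prod_roots (R : fieldType) (I : finType) (e : I -> R) (p : {poly R}) :
  injective e -> size p = #|I|.+1 -> (forall i, root p (e i)) ->
  p = lead_coef p *: \prod_i ('X - (e i)%:P).
Proof.
move=> e_inj size_p e_root.
rewrite {1}(@all_roots_prod_XsubC _ p (map e (index_enum I))) ?big_map //.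
- by rewrite size_map size_p cardT enumT.
- by apply/allP=> _ /mapP[i _ ->].
by rewrite uniq_rootsE map_inj_uniq // /index_enum -enumT enum_uniq.
Qed.

Lemma poly_base_expansion (R : fieldType) (h p : {poly R}) :
  (1 < size h)%N ->
  exists G : {poly {poly R}},
    (forall i, (size (G`_i)%R < size h)%N) /\ p = G.[h].
Proof.
move=> size_h; have h_neq0 : h != 0 by rewrite -size_poly_gt0 ltnW.
have [n] := ubnP (size p); elim: n p => // n IHn p size_p.
have [p0|p_neq0] := eqVneq p 0.
  by exists 0; rewrite p0 horner0; split=> // i; rewrite coef0 size_poly0 ltnW.
have [|G [size_G def_q]] := IHn (p %/ h).
  rewrite size_divp // -ltnS (leq_trans _ size_p) // ltnS ltn_subrL.
  by rewrite ltn_predRL size_h size_poly_gt0.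
exists (G * 'X + (p %% h)%:P); split=> [i|].
  by rewrite coefD coefMX coefC; case: i => [|i]; rewrite ?add0r ?addr0 ?ltn_modp.
by rewrite hornerMXaddC -def_q -divp_eq.
Qed.

(** Write [f] in base [h] with digits [G_i]. The polynomial [T = sum_i u^i G_i - y] has degree below
    [deg h] but vanishes on the [deg h] elements of [xs], so [T = 0]; as [u] is transcendental, the
    digits are constants. *)
Lemma poly_decomposition (k L : fieldType) (kap : {rmorphism k -> L})
    (f h : {poly k}) (y u : L) (xs : seq L) :
  (1 < size h)%N -> (forall Q, (map_poly kap Q).[u] = 0 -> Q = 0) ->
  uniq xs -> size xs = (size h).-1 ->
  {in xs, forall x, (map_poly kap f).[x] = y /\ (map_poly kap h).[x] = u} ->
  exists g, f = g \Po h.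
Proof.
move=> size_h u_transc xs_uniq size_xs xsP.
have [G [size_G def_f]] := poly_base_expansion f size_h.
pose T : {poly L} := \sum_(i < size G) u ^+ i *: map_poly kap G`_i - y%:P.
have T0 : T = 0.
  apply: (@roots_geq_poly_eq0 _ _ xs) => //.
    apply/allP=> x x_xs; have [fx hx] := xsP x x_xs.
    rewrite rootE hornerD hornerN hornerC subr_eq0 -fx def_f (horner_coef G).
    rewrite rmorph_sum !horner_sum; apply/eqP/eq_bigr => i _.
    by rewrite hornerZ rmorphM rmorphXn /= hornerM horner_exp hx mulrC.
  rewrite size_xs -ltnS (prednK (ltnW size_h)).
  apply: (leq_ltn_trans (size_polyD _ _)).
  rewrite gtn_max size_polyN (leq_ltn_trans (size_polyC_leq1 _)) // andbT.
  apply: (leq_ltn_trans (size_sum _ _ _)).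
  apply: (big_ind (fun m => m < size h)%N) => [|m1 m2|i _]; first exact: ltnW.
    by rewrite gtn_max => -> ->.
  by rewrite (leq_ltn_trans (size_scale_leq _ _)) // size_map_poly.
have G_const i j : G`_i`_j.+1 = 0.
  pose Q := \poly_(i < size G) G`_i`_j.+1.
  have Q0 : Q = 0.
    apply: u_transc; rewrite /Q poly_def rmorph_sum horner_sum.
    have := congr1 (fun p : {poly L} => p`_j.+1) T0.
    rewrite coefB coefC subr0 coef0 coef_sum => sum0.
    rewrite -[RHS]sum0; apply: eq_bigr => l _.
    by rewrite /= map_polyZ map_polyXn hornerZ hornerXn coefZ coef_map mulrC.
  have := congr1 (fun p : {poly k} => p`_i) Q0.
  rewrite coef_poly coef0; case: ltnP => // lei _.
  by rewrite (nth_default _ lei) coef0.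
exists (\poly_(i < size G) G`_i`_0); rewrite def_f /comp_poly; congr _.[_].
apply/polyP=> i; rewrite coef_map coef_poly /=; case: ltnP => [_|lei].
  by apply/polyP=> -[|j]; rewrite coefC ?G_const.
by rewrite (nth_default _ lei).
Qed.

(** * Transposition classes of a permutation group *)

Section TranspositionGraph.

Variables (T : finType) (G : {group {perm T}}).

Definition tperm_class (l : T) : {set T} := [set l' | tperm l l' \in G].

Lemma mem_tperm_class l l' : (l' \in tperm_class l) = (tperm l l' \in G).
Proof. by rewrite inE. Qed.

Lemma tperm_class_refl l : l \in tperm_class l.
Proof. by rewrite inE tperm1 group1. Qed.

Lemma tperm_class_sym l l' : (l' \in tperm_class l) = (l \in tperm_class l').
Proof. by rewrite !inE tpermC. Qed.

Lemma tperm_class_perm (s : {perm T}) l : s \in G ->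
  tperm_class (s l) = s @: tperm_class l.
Proof.
move=> sG; apply/setP=> l'; apply/idP/imsetP => [|[l1 + ->]].
  rewrite inE => sl; exists (s^-1%g l'); last by rewrite permKV.
  by rewrite inE -(groupJr _ sG) tpermJ permKV.
by rewrite !inE -tpermJ groupJr.
Qed.

(** The transposition [tperm l l'] of [G] carries the class of [l] to that of [l'], yet it only
    exchanges two members of the class of [l]. *)
Lemma tperm_class_trans l l' : l' \in tperm_class l ->
  tperm_class l' = tperm_class l.
Proof.
move=> ll'; have sG : tperm l l' \in G by rewrite -mem_tperm_class.
rewrite -{1}(tpermL l l') tperm_class_perm //; apply/setP => l1.
have [->|l1Nl] := eqVneq l1 l.
  rewrite -{1}(tpermR l l') mem_imset ?ll' ?tperm_class_refl //; exact: perm_inj.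
have [->|l1Nl'] := eqVneq l1 l'.
  rewrite -{1}(tpermL l l') mem_imset ?ll' ?tperm_class_refl //; exact: perm_inj.
by rewrite -{1}(@tpermD _ l l' l1) 1?eq_sym // mem_imset //; exact: perm_inj.
Qed.

End TranspositionGraph.

(** The symmetric groups of the fibers are generated by transpositions: composing [p] with
    [tperm x (p x)] leaves fewer moved points. *)
Lemma fiber_perm_mem (S : finType) (d : nat) (G : {group {perm S * 'I_d}}) :
  (forall s i j, tperm (s, i) (s, j) \in G) ->
  forall p : {perm S * 'I_d}, (forall x, (p x).1 = x.1) -> p \in G.
Proof.
move=> tG p; have [n] := ubnP #|[set x | p x != x]|.
elim: n p => // n IHn p lt_n p1.
have [x px|p_id] := pickP (fun x => p x != x); last first.
  suff -> : p = 1%g by apply: group1.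
  by apply/permP=> x; rewrite perm1; apply/eqP/negbFE/p_id.
pose t := tperm x (p x).
have t1 y : (t y).1 = y.1 by rewrite /t; case: tpermP => [->|->|].
have tG' : t \in G.
  by rewrite /t [x]surjective_pairing [p _]surjective_pairing p1.
suff : (p * t)%g \in G by rewrite groupMr.
apply: IHn => [|y]; last by rewrite permM t1 p1.
rewrite -ltnS (leq_trans _ lt_n) // ltnS proper_card //; apply/properP; split.
  apply/subsetP=> y; rewrite !inE permM; apply: contraNneq => py.
  have y_x : y != x by apply: contraNneq px => <-; rewrite py.
  rewrite py /t tpermD // 1?eq_sym //; apply: contraNneq y_x => y_px.
  by rewrite -(inj_eq (@perm_inj _ p)) py y_px.
by exists x; rewrite !inE ?permM ?tpermR ?eqxx.
Qed.

Lemma poly_splits (R : fieldType) (p : {poly R}) :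
  p != 0 ->
  (forall q, q %| p -> (1 < size q)%N -> exists z, root q z) ->
  exists rs, p = lead_coef p *: \prod_(z <- rs) ('X - z%:P).
Proof.
have [n] := ubnP (size p); elim: n p => // n IHn p size_p p_neq0 p_root.
have [p_le1|p_gt1] := leqP (size p) 1.
  exists [::]; rewrite big_nil (size1_polyC p_le1) lead_coefC.
  by rewrite alg_polyC.
have [z /factor_theorem[q def_p]] := p_root p (dvdpp p) p_gt1.
have q_neq0 : q != 0 by apply: contraNneq p_neq0; rewrite def_p => ->; rewrite mul0r.
have [||rs def_q] := IHn q _ q_neq0.
- by move: size_p; rewrite def_p size_Mmonic ?monicXsubC // size_XsubC addn2.
- by move=> r r_q; apply: p_root; rewrite def_p dvdp_mulr.
have -> : lead_coef p = lead_coef q.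
  by rewrite def_p lead_coefM lead_coefXsubC mulr1.
by exists (z :: rs); rewrite big_cons def_p {1}def_q mulrC scalerAr.
Qed.

(** * Galois action on the roots *)

Section SpecializationTheory.

Variables (L : fieldType) (k : closedFieldType) (kap : {rmorphism k -> L}).
Variables (x : L) (w : k) (xs : seq L) (sp : L -> k -> Prop).
Hypothesis spP : specialization kap x w xs sp.

Lemma spec_inj b a a' : sp b a -> sp b a' -> a = a'.
Proof. by case: spP => inj _ _ _ _; apply: inj. Qed.

Lemma spec_const c : sp (kap c) c.
Proof. by case: spP. Qed.

Lemma specD b a b' a' : sp b a -> sp b' a' -> sp (b + b') (a + a').
Proof. by case: spP => _ _ ring _ _ ba b'a'; case: (ring _ _ _ _ ba b'a'). Qed.

Lemma specM b a b' a' : sp b a -> sp b' a' -> sp (b * b') (a * a').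
Proof. by case: spP => _ _ ring _ _ ba b'a'; case: (ring _ _ _ _ ba b'a'). Qed.

Lemma specB b a b' a' : sp b a -> sp b' a' -> sp (b - b') (a - a').
Proof.
move=> ba b'a'; rewrite -mulN1r -[- a']mulN1r; apply: specD => //.
by apply: specM => //; rewrite -(rmorph1 kap) -rmorphN; apply: spec_const.
Qed.

Lemma spec_sum (I : Type) (r : seq I) (P : pred I) (B : I -> L) (A : I -> k) :
  (forall i, P i -> sp (B i) (A i)) ->
  sp (\sum_(i <- r | P i) B i) (\sum_(i <- r | P i) A i).
Proof.
move=> BA; apply: (big_ind2 sp) => [|b a b' a'|i] //; last exact: BA.
  by rewrite -(rmorph0 kap); apply: spec_const.
exact: specD.
Qed.

Lemma spec_prod (I : Type) (r : seq I) (P : pred I) (B : I -> L) (A : I -> k) :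
  (forall i, P i -> sp (B i) (A i)) ->
  sp (\prod_(i <- r | P i) B i) (\prod_(i <- r | P i) A i).
Proof.
move=> BA; apply: (big_ind2 sp) => [|b a b' a'|i] //; last exact: BA.
  by rewrite -(rmorph1 kap); apply: spec_const.
exact: specM.
Qed.

Lemma spec_horner (Q : {poly k}) z a : sp z a -> sp (map_poly kap Q).[z] Q.[a].
Proof.
move=> za; elim/poly_ind: Q => [|Q c IHQ].
  by rewrite rmorph0 !horner0 -(rmorph0 kap); apply: spec_const.
rewrite rmorphD rmorphM /= map_polyX map_polyC !hornerMXaddC.
by apply: specD; [apply: specM | apply: spec_const].
Qed.

Lemma spec_choice : exists alpha : L -> k, {in xs, forall z, sp z (alpha z)}.
Proof.
exists (fun z => epsilon (inhabits 0) (sp z)) => z z_xs; apply: epsilon_spec.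
by case: spP => _ _ _ _; apply.
Qed.

End SpecializationTheory.

(** * Elements transcendental over [k] *)

Section Transcendental.

Variables (L : fieldType) (k : closedFieldType) (kap : {rmorphism k -> L}).

Local Notation "Q ^k" := (map_poly kap Q) (at level 2, format "Q ^k").

(** As [k] is algebraically closed, an element [z] algebraic over [k] lies in the image of [kap],
    and so would [y = F(z)]. *)
Lemma transc_horner (F : {poly k}) y z :
  transc kap y -> F^k.[z] = y -> transc kap z.
Proof.
move=> y_transc Fz Q Qz; apply/eqP/contraT => Q_neq0.
have [r Qr] := closed_field_poly_normal Q.
have: root Q^k z by apply/rootP.
rewrite Qr map_polyZ rootZ ?fmorph_eq0 ?lead_coef_eq0 // rmorph_prod /=.
rewrite (eq_bigr (fun c => 'X - (kap c)%:P)) => [|c _]; last first.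
  by rewrite rmorphB /= map_polyX map_polyC.
rewrite -(big_map kap xpredT (fun c => 'X - c%:P)) root_prod_XsubC.
case/mapP=> c _ zc.
have /y_transc/eqP : ('X - F.[c]%:P)^k.[y] = 0.
  by rewrite rmorphB /= map_polyX map_polyC !hornerE -Fz zc horner_map subrr.
by rewrite polyXsubC_eq0.
Qed.

(** A multiple root [z] would satisfy [F'(z) = 0], while [z] is transcendental because [F(z) = y]
    is. *)
Lemma separable_sub_transc (F : {poly k}) y :
  F^`() != 0 -> transc kap y ->
  (forall q, q %| F^k - y%:P -> (1 < size q)%N -> exists z, root q z) ->
  separable_poly (F^k - y%:P).
Proof.
move=> F'_neq0 y_transc p_root; set p := F^k - y%:P in p_root *.
have p'E : p^`() = F^`()^k by rewrite derivB derivC subr0 deriv_map.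
rewrite unlock; apply/negPn/negP => gcd_neq1.
have [|z] := p_root _ (dvdp_gcdl p p^`()).
  rewrite ltn_neqAle eq_sym gcd_neq1 size_poly_gt0 gcdp_eq0 p'E.
  by rewrite map_poly_eq0 (negPf F'_neq0) andbF.
rewrite root_gcd p'E rootE hornerD hornerN hornerC subr_eq0.
case/andP=> /eqP /(transc_horner y_transc) z_transc /rootP/z_transc F'0.
by rewrite F'0 eqxx in F'_neq0.
Qed.

End Transcendental.

(* [L] contains the rational function field [F0 = k(tau)], whose elements are
   fractions in [tau]. *)
Section GaloisAction.

Variables (k : closedFieldType) (F0 : fieldType) (L : splittingFieldType F0).
Variables (E : {subfield L}) (kap : {rmorphism k -> L}) (tau : L).
Hypothesis galE : galois 1%AS E.
Hypothesis kap_alg : forall c, exists r : F0, kap c = r%:A.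
Hypothesis tau_alg : exists r : F0, tau = r%:A.
Hypothesis tau_transc : transc kap tau.
Hypothesis tau_gen : forall r : F0, exists A Q : {poly k},
  Q != 0 /\ r%:A * (map_poly kap Q).[tau] = (map_poly kap A).[tau].

Local Notation "Q ^k" := (map_poly kap Q) (at level 2, format "Q ^k").

Lemma gal_const (s : gal_of E) c : s (kap c) = kap c.
Proof. by have [r ->] := kap_alg c; rewrite linearZ rmorph1. Qed.

Lemma gal_tau (s : gal_of E) : s tau = tau.
Proof. by have [r ->] := tau_alg; rewrite linearZ rmorph1. Qed.

Lemma mem_const c : kap c \in E.
Proof. by have [r ->] := kap_alg c; rewrite rpredZ ?mem1v. Qed.

Let transc_root (F : {poly k}) z : F^k.[z] = tau -> transc kap z.
Proof. exact: transc_horner. Qed.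

Lemma gal_horner (s : gal_of E) (Q : {poly k}) z : s (Q^k.[z]) = Q^k.[s z].
Proof.
rewrite -horner_map -map_poly_comp; congr _.[_].
by apply: eq_map_poly => c /=; rewrite gal_const.
Qed.

(** The coefficients of [P] are fractions in [tau], and [tau = F(z)] at each root; hence a single
    [W] serves all roots of [F - tau] at once. *)
Lemma clear_denominators (F : {poly k}) (P : {poly L}) :
  P \is a polyOver 1%VS ->
  exists D W : {poly k}, D != 0 /\
    forall z, F^k.[z] = tau -> D^k.[tau] * P.[z] = W^k.[z].
Proof.
case/polyOver1P=> {}P ->; elim/poly_ind: P => [|P c [D [W [D_neq0 IHP]]]].
  exists 1, 0; rewrite oner_neq0; split=> // z _.
  by rewrite !rmorph0 !horner0 mulr0.
have [A [Q [Q_neq0 cQ]]] := tau_gen c.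
exists (D * Q), ((Q \Po F) * W * 'X + (D \Po F) * (A \Po F)).
rewrite mulf_neq0 //; split=> // z Fz.
rewrite !rmorphD !rmorphM /= !map_comp_poly !map_polyX map_polyC.
rewrite !hornerE !horner_comp Fz -(IHP z Fz) -cQ /=.
by rewrite mulrDr !mulrA; congr (_ + _); [rewrite -!mulrA mulrCA | rewrite mulrAC].
Qed.

(** This is the irreducibility of [F - tau]: the minimal polynomial of [x], cleared of denominators,
    becomes [W] with [W(x) = 0], so [W = 0] and the minimal polynomial also vanishes at [y]. *)
Lemma gal_conj (F : {poly k}) x y :
  (1 < size F)%N -> x \in E -> F^k.[x] = tau -> F^k.[y] = tau ->
  exists2 s : gal_of E, s \in 'Gal(E / 1%AS)%g & s x = y.
Proof.
move=> size_F xE Fx Fy; case/and3P: galE => le1E _ normE.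
apply: normalField_root_minPoly => //.
have [D [W [D_neq0 DW]]] := clear_denominators F (minPolyOver 1%AS x).
have W0 : W = 0.
  by apply: (transc_root Fx); rewrite -(DW x Fx) minPolyxx mulr0.
have /eqP := DW y Fy; rewrite W0 rmorph0 horner0 mulf_eq0 => /orP[|//].
by move/eqP/tau_transc => D0; rewrite D0 eqxx in D_neq0.
Qed.

(** By the Galois correspondence [c] lies in [F0(x)], which is [k(x)] since [tau = F(x)]; the
    fraction is then reduced. *)
Lemma fixed_fraction (F : {poly k}) x c :
  (1 < size F)%N -> x \in E -> F^k.[x] = tau -> c \in E ->
  {in 'Gal(E / <<1; x>>%AS)%g, forall s : gal_of E, s c = c} ->
  exists A Q : {poly k}, coprimep A Q /\ c * Q^k.[x] = A^k.[x].
Proof.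
move=> size_F xE Fx cE c_fix.
have [P P1 cP] : exists2 P, P \is a polyOver 1%VS & c = P.[x].
  apply/Fadjoin_polyP.
  have /galois_fixedField <- : galois <<1; x>>%AS E.
    by apply: galoisS galE; rewrite subv_adjoin; apply/FadjoinP; rewrite sub1v.
  exact/fixedFieldP.
have [D [W [D_neq0 /(_ x Fx)]]] := clear_denominators F P1.
rewrite -cP -Fx -horner_comp -map_comp_poly => DW.
pose Q := D \Po F; pose g := gcdp W Q.
have Q_neq0 : Q != 0 by rewrite comp_poly_eq0.
have g_neq0 : g != 0 by rewrite gcdp_eq0 negb_and Q_neq0 orbT.
have gx_neq0 : g^k.[x] != 0.
  by apply: contra_neq g_neq0 => /(transc_root Fx).
exists (W %/ g), (Q %/ g); split; first by rewrite coprimep_div_gcd // Q_neq0 orbT.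
apply: (mulIf gx_neq0).
by rewrite -mulrA -!hornerM -!rmorphM !divpK ?dvdp_gcdl ?dvdp_gcdr // mulrC.
Qed.

(* Two specializations which agree at [x1] agree on its fixed field, hence are
   conjugate under the stabilizer of [x1]: otherwise a generic [k]-linear
   combination [b] of [xs] would have no conjugate over [x1] with the right
   value, although the norm of [kap v - b] is a fraction in [x1]. *)
Lemma inertia (F : {poly k}) x w (xs : seq L) sp x1 x2 :
  (1 < size F)%N -> specialization kap x w xs sp ->
  {in xs, forall z, F^k.[z] = tau} -> {subset xs <= E} ->
  (forall s : gal_of E, {in xs, forall z, s z \in xs}) ->
  x1 \in xs -> x2 \in xs -> sp x1 w -> sp x2 w ->
  exists s : gal_of E, [/\ s \in 'Gal(E / 1%AS)%g, s x1 = x2 &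
    {in xs, forall z a, sp z a -> sp (s z) a}].
Proof.
move=> size_F spP xsF xsE xs_stable x1_xs x2_xs sp1 sp2.
have [s0 s0G s0x] := gal_conj size_F (xsE _ x1_xs) (xsF _ x1_xs) (xsF _ x2_xs).
have [alpha alphaP] := spec_choice spP.
pose H := 'Gal(E / <<1; x1>>%AS)%G.
have sub_H : H \subset 'Gal(E / 1%AS)%g by apply: galS; apply: sub1v.
suff [h hH hP] : exists2 h : gal_of E, h \in H &
    {in xs, forall z, alpha (h z) = alpha (s0 z)}.
  (* Products in the Galois group act from left to right: first [h^-1], which fixes [x1], then
     [s0]. *)
  exists (h^-1 * s0)%g; split; first by rewrite groupMl ?groupV // (subsetP sub_H).
    rewrite galM ?xsE // -[RHS]s0x; congr (s0 _).
    apply: (fixed_gal _ (groupVr hH)); last exact: memv_adjoin.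
    by apply/FadjoinP; rewrite sub1v xsE.
  move=> z z_xs a za; rewrite galM ?xsE //.
  have hz_xs := xs_stable h^-1%g z z_xs.
  have := hP _ hz_xs; rewrite -galM ?xsE // mulVg gal_id.
  rewrite (spec_inj spP za (alphaP _ z_xs)) => ->.
  by apply: alphaP; apply: xs_stable.
apply: NNPP => no_h.
(* The value of [q s] at [u] is the specialization of [s b], where [b] has coefficients [u^i]; [u]
   is chosen to separate [s0] from all of [H]. *)
pose q (s : gal_of E) := \poly_(i < size xs) alpha (s xs`_i).
have [u] : exists u, ~~ root (\prod_(h in H) (q s0 - q h)) u.
  apply/closed_nonrootP/prodf_neq0 => h hH; rewrite subr_eq0.
  apply/eqP=> q_eq; apply: no_h; exists h => // z z_xs.
  have := congr1 (fun p : {poly k} => p`_(index z xs)) q_eq.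
  by rewrite !coef_poly index_mem z_xs nth_index.
rewrite rootE horner_prod => /prodf_neq0 u_neq0.
pose b := \sum_(i < size xs) kap (u ^+ i) * xs`_i.
have bE : b \in E.
  apply: memv_suml => i _; rewrite memvM ?mem_const //.
  by rewrite xsE ?mem_nth.
have sb (s : gal_of E) : sp (s b) (q s).[u].
  rewrite rmorph_sum horner_poly; apply: (spec_sum spP) => i _.
  rewrite rmorphM /= gal_const mulrC; apply: (specM spP); last exact: (spec_const spP).
  by apply: alphaP; apply/xs_stable/mem_nth.
pose v := (q s0).[u]; pose c := \prod_(h in H) (kap v - h b).
have cE : c \in E.
  by apply: rpred_prod => h _; rewrite memvB ?mem_const ?memv_gal.
have c_fix : {in H, forall s : gal_of E, s c = c}.
  move=> s sH; rewrite rmorph_prod /= [RHS](reindex_inj (mulIg s)) /=.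
  apply: eq_big => h; first by rewrite groupMr.
  by move=> _; rewrite rmorphB /= gal_const galM.
have [A [Q [coAQ cQ]]] :=
  fixed_fraction size_F (xsE _ x1_xs) (xsF _ x1_xs) cE c_fix.
have spc : sp c (\prod_(h in H) (v - (q h).[u])).
  by apply: (spec_prod spP) => h _; apply: (specB spP (spec_const spP v) (sb h)).
(* The factor [h = 1] vanishes, since [v] is the value of [s0 b]. *)
have sps0c : sp (s0 c) 0.
  have -> : 0 = \prod_(h in H) (v - (q (h * s0)%g).[u]).
    by rewrite (bigD1 1%g) ?group1 //= mul1g subrr mul0r.
  rewrite rmorph_prod; apply: (spec_prod spP) => h _.
  rewrite rmorphB /= gal_const -galM //.
  exact: (specB spP (spec_const spP v) (sb _)).
(* Specialize [c Q(x1) = A(x1)] and its conjugate [s0(c) Q(x2) = A(x2)]. Both [x1] and [x2] go to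
   [w], so the second gives [A(w) = 0], whence [Q(w) <> 0]; by the first, [c] then specializes to 0,
   against the choice of [u]. *)
have := spec_inj spP (specM spP sps0c (spec_horner spP Q sp2)).
have := spec_inj spP (specM spP spc (spec_horner spP Q sp1)).
have := congr1 s0 cQ; rewrite rmorphM /= !gal_horner s0x => -> /=.
rewrite cQ => /(_ _ (spec_horner spP A sp1)) cQw.
move=> /(_ _ (spec_horner spP A sp2)); rewrite mul0r => Aw.
have Qw : Q.[w] != 0 by apply: coprimep_root coAQ _; apply/rootP.
move/eqP: cQw; rewrite -Aw mulf_eq0 (negPf Qw) orbF => /prodf_eq0[h hH].
by have := u_neq0 h hH; rewrite hornerD hornerN => /negPf->.
Qed.

(** If the reduced denominator [Q] had a root [w], specializing [x] to [w] would give [c] a finite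
    value and force [A(w) = 0], against coprimality. The integrality of [c] enters as its having a
    value under every specialization. *)
Lemma fixed_polynomial (F : {poly k}) x (xs : seq L) c :
  (1 < size F)%N -> x \in xs -> {in xs, forall z, F^k.[z] = tau} ->
  {subset xs <= E} -> c \in E ->
  {in 'Gal(E / <<1; x>>%AS)%g, forall s : gal_of E, s c = c} ->
  (forall w sp, specialization kap x w xs sp -> exists a, sp c a) ->
  exists h : {poly k}, c = h^k.[x].
Proof.
move=> size_F x_xs xsF xsE cE c_fix c_spec.
have [A [Q [coAQ cQ]]] :=
  fixed_fraction size_F (xsE _ x_xs) (xsF _ x_xs) cE c_fix.
have [/eqP/size_poly1P[q q_neq0 def_Q]|/closed_rootP[w Qw]] :=
  eqVneq (size Q) 1%N.
  exists (q^-1 *: A); rewrite map_polyZ hornerZ -cQ def_Q map_polyC hornerC /=.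
  by rewrite mulrCA -rmorphM mulVf // rmorph1 mulr1.
have [|sp spP] :=
    exists_specialization w size_F (transc_root (xsF _ x_xs)) (xs := xs).
  by move=> z z_xs; rewrite !xsF.
have [a ca] := c_spec w sp spP.
have xw : sp x w by case: spP.
have := spec_inj spP (specM spP ca (spec_horner spP Q xw)).
rewrite cQ => /(_ _ (spec_horner spP A xw)).
rewrite (rootP Qw) mulr0 => /esym Aw.
by have := coprimep_root coAQ (introT rootP Aw); rewrite (rootP Qw) eqxx.
Qed.

(** * The Galois group as a permutation group; a transposition from a simple critical point *)

Section RootPermutation.

Variables (T : finType) (e : T -> L) (F : {poly k}).
Hypothesis size_F : (1 < size F)%N.
Hypothesis e_inj : injective e.
Hypothesis eE : forall l, e l \in E.
Hypothesis eF : forall l, F^k.[e l] = tau.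
Hypothesis e_onto : forall z, F^k.[z] = tau -> exists l, z = e l.

Definition root_fun (s : gal_of E) (l : T) : T :=
  odflt l [pick l' | e l' == s (e l)].

Lemma root_funE s l : e (root_fun s l) = s (e l).
Proof.
rewrite /root_fun; case: pickP => [l' /eqP //|no_l].
have [l' l'P] : exists l', s (e l) = e l'.
  by apply: e_onto; rewrite -gal_horner eF gal_tau.
by have := no_l l'; rewrite l'P eqxx.
Qed.

Lemma root_fun_inj s : injective (root_fun s).
Proof.
by move=> l l' /(congr1 e); rewrite !root_funE => /fmorph_inj/e_inj.
Qed.

Definition root_perm s : {perm T} := perm (@root_fun_inj s).

Lemma root_permE s l : e (root_perm s l) = s (e l).
Proof. by rewrite permE root_funE. Qed.

Lemma root_permM :
  {in 'Gal(E / 1%AS)%g &, {morph root_perm : s t / (s * t)%g >-> (s * t)%g}}.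
Proof.
move=> s t _ _; apply/permP=> l; apply: e_inj.
by rewrite permM !root_permE galM.
Qed.

Definition root_morphism : {morphism 'Gal(E / 1%AS)%g >-> {perm T}} :=
  Morphism root_permM.

Definition root_group : {group {perm T}} := (root_morphism @* 'Gal(E / 1%AS))%G.

Lemma root_groupP (p : {perm T}) :
  reflect
    (exists2 s : gal_of E, s \in 'Gal(E / 1%AS)%g & forall l, e (p l) = s (e l))
    (p \in root_group).
Proof.
apply: (iffP morphimP) => [[s _ sG ->]|[s sG sP]].
  by exists s => // l; apply: root_permE.
by exists s => //; apply/permP=> l; apply: e_inj; rewrite root_permE.
Qed.

Lemma root_group_trans l l' : exists2 p, p \in root_group & p l = l'.
Proof.
have [s sG sl] := gal_conj size_F (eE l) (eF l) (eF l').
exists (root_perm s).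
  by apply/root_groupP; exists s => // j; apply: root_permE.
by apply: e_inj; rewrite root_permE.
Qed.

Let xs := map e (enum T).

Let mem_xs l : e l \in xs.
Proof. by rewrite map_f ?mem_enum. Qed.

Let xsP z : z \in xs -> exists l, z = e l.
Proof. by case/mapP=> l _ ->; exists l. Qed.

Let xsF : {in xs, forall z, F^k.[z] = tau}.
Proof. by move=> _ /xsP[l ->]. Qed.

Let xsE : {subset xs <= E}.
Proof. by move=> _ /xsP[l ->]. Qed.

Let xs_stable (s : gal_of E) : {in xs, forall z, s z \in xs}.
Proof. by move=> _ /xsP[l ->]; rewrite -root_permE. Qed.

Hypothesis size_FT : size F = #|T|.+1.

(* Specializing [F - tau = c \prod_l (X - e l)] shows that exactly two roots
   [e l0], [e l1] collide at a simple critical point [w], and no others do. *)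
Lemma simple_critical_point_tperm w :
  root F^`() w -> ~~ (('X - w%:P) ^+ 3 %| F - F.[w]%:P) ->
  (forall v, root F^`() v -> F.[v] = F.[w] -> v = w) ->
  exists l0 l1, l0 != l1 /\ tperm l0 l1 \in root_group.
Proof.
move=> w_crit w_cube crit_uniq.
have l0 : T.
  move: size_F; rewrite size_FT ltnS => /card_gt0P; case/sigW=> l _; exact: l.
have [|sp spP] :=
    exists_specialization w size_F (transc_root (eF l0)) (xs := xs).
  by move=> z z_xs; rewrite xsF ?eF.
have [alpha0 alpha0P] := spec_choice spP; pose alpha l := alpha0 (e l).
have alphaP l : sp (e l) (alpha l) by apply: alpha0P.
have alpha_l0 : alpha l0 = w.
  by apply: (spec_inj spP (alphaP l0)); case: spP.
have lcF_neq0 : lead_coef F != 0 by rewrite lead_coef_eq0 -size_poly_gt0 ltnW.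
have size_FL : size (F^k - tau%:P) = size F.
  rewrite size_polyDl size_map_poly // size_polyN.
  by rewrite (leq_ltn_trans (size_polyC_leq1 _)).
have prodL : F^k - tau%:P = kap (lead_coef F) *: \prod_l ('X - (e l)%:P).
  rewrite {1}(@poly_prod_roots _ _ e (F^k - tau%:P)) ?size_FL //; last first.
    by move=> l; rewrite rootE !hornerE eF subrr.
  congr (_ *: _); rewrite lead_coefDl ?lead_coef_map //.
  by rewrite size_map_poly size_polyN (leq_ltn_trans (size_polyC_leq1 _)).
(* The two sides agree at every [v] of [k], as specializations of the factored [F - tau] at
   [kap v]. *)
have prodk : F - F.[w]%:P = lead_coef F *: \prod_l ('X - (alpha l)%:P).
  apply/eqP; rewrite -subr_eq0; apply: contraT => /closed_nonrootP[v].
  rewrite rootE !hornerE subr_eq0 horner_prod => /eqP[].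
  apply: (spec_inj spP (b := (F^k - tau%:P).[kap v])).
    rewrite hornerD hornerN hornerC horner_map -(eF l0) /=.
    apply: (specB spP); first exact: (spec_const spP).
    by apply: (spec_horner spP); rewrite -alpha_l0.
  rewrite prodL hornerZ horner_prod; apply: (specM spP (spec_const spP _)).
  apply: (spec_prod spP) => l _; rewrite !hornerE.
  exact: (specB spP (spec_const spP v) (alphaP l)).
have derivF : (F - F.[w]%:P)^`() = F^`() by rewrite derivB derivC subr0.
have alphaF l : F.[alpha l] = F.[w].
  apply/eqP; rewrite -subr_eq0.
  have -> : F.[alpha l] - F.[w] = (F - F.[w]%:P).[alpha l] by rewrite !hornerE.
  by rewrite prodk hornerZ horner_prod (bigD1 l) //= hornerXsubC subrr mul0r mulr0.
(* A value taken twice by [alpha] is a double root of [F - F(w)], hence a critical point with the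
   same image as [w]. *)
have collide l l' : l != l' -> alpha l = alpha l' -> alpha l = w.
  move=> l_l' eq_alpha; apply: crit_uniq (alphaF l).
  rewrite -derivF prodk derivZ rootZ // (bigD1 l) //= (bigD1 l') 1?eq_sym //=.
  rewrite -eq_alpha mulrA -expr2 derivM deriv_exp rootE !hornerE.
  by rewrite subrr /= ?expr0n /= ?(mul0r, mulr0, mul0rn, addr0).
have [l1 l1_l0 alpha_l1] : exists2 l1, l1 != l0 & alpha l1 = w.
  move: w_crit; rewrite -derivF prodk derivZ rootZ // (bigD1 l0) //=.
  rewrite derivM derivXsubC mul1r rootE hornerD hornerM alpha_l0 hornerXsubC.
  rewrite subrr mul0r addr0 horner_prod => /eqP/eqP/prodf_eq0[l1 l1_l0].
  by rewrite hornerXsubC subr_eq0 => /eqP ->; exists l1.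
have only_two l : alpha l = w -> l = l0 \/ l = l1.
  move=> alpha_l; have [->|l_l0] := eqVneq l l0; first by left.
  have [->|l_l1] := eqVneq l l1; first by right.
  case/negP: w_cube; rewrite prodk dvdpZr // (bigD1 l0) //= (bigD1 l1) //=.
  rewrite (bigD1 l) ?l_l0 //= alpha_l0 alpha_l1 alpha_l !mulrA.
  by rewrite dvdp_mulr // !exprS expr0 mulr1 mulrA.
have sp_l1 : sp (e l1) w by rewrite -alpha_l1.
have sp_l0 : sp (e l0) w by rewrite -alpha_l0.
have [s [sG s_l0 s_sp]] := inertia size_F spP xsF xsE xs_stable
  (mem_xs l0) (mem_xs l1) sp_l0 sp_l1.
have alpha_s l : alpha (root_perm s l) = alpha l.
  apply: (spec_inj spP (alphaP _)); rewrite root_permE.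
  exact: s_sp (mem_xs l) _ (alphaP l).
have p_l0 : root_perm s l0 = l1 by apply: e_inj; rewrite root_permE.
exists l0, l1; rewrite eq_sym; split=> //.
apply/root_groupP; exists s => // l; rewrite -root_permE; congr e.
(* The permutation preserves [alpha], which is injective away from the value [w]; so it fixes every
   index but [l0] and [l1], and having sent [l0] to [l1] it must send [l1] back. *)
case: tpermP => [->|->|/eqP l_l0 /eqP l_l1]; rewrite ?p_l0 //.
  case: (only_two (root_perm s l1)); rewrite ?alpha_s // => p_l1.
  by move: l1_l0; rewrite -(inj_eq (@perm_inj _ (root_perm s))) p_l0 p_l1 eqxx.
apply/eqP/contraT => /collide /(_ (esym (alpha_s l))) /only_two.
by case=> eq_l; rewrite eq_l eqxx in l_l0 l_l1.
Qed.

End RootPermutation.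

(** * From one transposition to all transpositions of siblings *)

Section Fibers.

Variables (S : finType) (d : nat) (f F1 F : {poly k}).
Variables (e0 : S -> L) (e : S * 'I_d -> L).
Hypotheses (d_ge2 : (2 <= d)%N) (size_f : size f = d.+1).
Hypothesis f_indec : indecomposable f.
Hypothesis e0_inj : injective e0.
Hypothesis e0F : forall s, F1^k.[e0 s] = tau.
Hypothesis fe : forall l, f^k.[e l] = e0 l.1.
Hypothesis size_F : (1 < size F)%N.
Hypothesis e_inj : injective e.
Hypothesis eE : forall l, e l \in E.
Hypothesis eF : forall l, F^k.[e l] = tau.
Hypothesis e_onto : forall z, F^k.[z] = tau -> exists l, z = e l.

Local Notation G := (root_group e_inj eE eF e_onto).
Local Notation C := (tperm_class G).

(** As [d >= 2], [l] has another sibling. If [l'] were in another fiber, the transposition would fix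
    this sibling, so the automorphism would fix [e0 l.1]; but it sends [e l] to [e l'], hence
    [e0 l.1] to [e0 l'.1]. *)
Lemma tperm_class_sibling l l' : l' \in C l -> l'.1 = l.1.
Proof.
rewrite mem_tperm_class => /root_groupP[s _ sP]; apply/eqP/contraT => l'Nl.
have [j jNl] : exists j : 'I_d, j != l.2.
  have [lt0 lt1] : (0 < d)%N /\ (1 < d)%N by rewrite ltnW.
  have [<-|l2] := eqVneq (Ordinal lt0) l.2; last by exists (Ordinal lt0).
  by exists (Ordinal lt1).
have fix_lj : tperm l l' (l.1, j) = (l.1, j).
  rewrite tpermD //; first by apply: contraNneq jNl => ->.
  by apply: contraNneq l'Nl => ->.
case/eqP: l'Nl; apply: e0_inj; rewrite -fe -(tpermL l l') sP -gal_horner fe.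
by rewrite -[l.1]/((l.1, j).1) -fe gal_horner -sP fix_lj.
Qed.

Lemma card_tperm_class l l' : #|C l| = #|C l'|.
Proof.
have [p pG <-] := root_group_trans size_F e_inj eE eF e_onto l' l.
by rewrite tperm_class_perm // card_imset //; apply: perm_inj.
Qed.

Lemma card_class_fiber s j : #|[pred i | (s, j) \in C (s, i)]| = #|C (s, j)|.
Proof.
rewrite -[LHS](@card_imset _ _ (pair s)); last by move=> i i' [].
apply: eq_card => l.
apply/imsetP/idP => [[i + ->]|lC]; first by rewrite inE tperm_class_sym.
case: l lC => s' i /[dup] /tperm_class_sibling /= -> lC.
by exists i; rewrite // inE tperm_class_sym.
Qed.

Let u l := \prod_(l' in C l) e l'.

Lemma gal_class_prod (s : gal_of E) l : s \in 'Gal(E / 1%AS)%g ->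
  s (u l) = u (root_perm e_inj eF e_onto s l).
Proof.
move=> sG; rewrite /u rmorph_prod tperm_class_perm; last first.
  by apply/root_groupP; exists s => // l'; apply: root_permE.
rewrite big_imset /=; last by move=> l1 l2 _ _; apply: perm_inj.
by apply: eq_bigr => l' _; rewrite root_permE.
Qed.

(** The product at [l0] is fixed by the stabilizer of [e l0] and has a value under every
    specialization, so [fixed_polynomial] applies; transitivity carries the same [h] to all [l]. The
    argument in [S * 'I_d] supplies the base point. *)
Lemma class_prod_poly :
  S * 'I_d -> exists h : {poly k}, forall l, u l = h^k.[e l].
Proof.
move=> l0; pose xs := map e (enum {: S * 'I_d}).
have mem_xs l : e l \in xs by rewrite map_f ?mem_enum.
have xsP z : z \in xs -> exists l, z = e l by case/mapP=> l _ ->; exists l.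
have [|||||||h hP] := @fixed_polynomial F (e l0) xs (u l0) => //.
- by move=> _ /xsP[l ->].
- by move=> _ /xsP[l ->].
- by apply: rpred_prod => l _; apply: eE.
- move=> s sG; have s1 : s \in 'Gal(E / 1%AS)%g.
    by apply: (subsetP (galS _ _)) sG; apply: sub1v.
  rewrite gal_class_prod //; congr u; apply: e_inj; rewrite root_permE.
  apply: (fixed_gal _ sG); last exact: memv_adjoin.
  by apply/FadjoinP; rewrite sub1v eE.
- move=> w sp spP; have [alpha alphaP] := spec_choice spP.
  exists (\prod_(l in C l0) alpha (e l)); apply: (spec_prod spP) => l _.
  exact: alphaP.
exists h => l; have [s sG se] := gal_conj size_F (eE l0) (eF l0) (eF l).
rewrite -se -gal_horner -hP gal_class_prod //; congr u; apply: e_inj.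
by rewrite root_permE se.
Qed.

(* Comparing the degrees in [y] of [\prod_(i < d) h (e (s, i))], where the
   [e (s, i)] are the roots of [f - y], computed in two ways. *)
Lemma size_class_prod_poly (h : {poly k}) l :
  (forall l, u l = h^k.[e l]) -> size h = #|C l|.+1.
Proof.
move=> hP; case: l => s j0; set m := #|_|; set a := kap (lead_coef f).
have f_neq0 : f != 0 by rewrite -size_poly_gt0 size_f.
have a_neq0 : a != 0 by rewrite fmorph_eq0 lead_coef_eq0.
have size_y : (size (- (e0 s)%:P : {poly L})%R < size f^k)%N.
  rewrite size_polyN size_map_poly size_f.
  by rewrite (leq_ltn_trans (size_polyC_leq1 _)) // ltnS ltnW.
have prod_f c : \prod_i (kap c - e (s, i)) = a^-1 * (kap f.[c] - e0 s).
  have size_fy : size (f^k - (e0 s)%:P) = d.+1.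
    by rewrite size_polyDl // size_map_poly.
  have : f^k - (e0 s)%:P = a *: \prod_i ('X - (e (s, i))%:P).
    rewrite {1}(@poly_prod_roots _ _ (fun i => e (s, i)) (f^k - (e0 s)%:P)).
    - by congr (_ *: _); rewrite lead_coefDl ?lead_coef_map.
    - by move=> i j /e_inj[].
    - by rewrite size_fy card_ord.
    by move=> i; rewrite rootE !hornerE fe subrr.
  move/(congr1 (fun p : {poly L} => p.[kap c])).
  rewrite hornerD hornerN hornerC horner_map hornerZ horner_prod => ->.
  by rewrite mulKf //; apply: eq_bigr => i _; rewrite hornerXsubC.
(* With [y = e0 s], the product of the [e (s, i) - c] is [(-1)^d (f(c) - y) / lead_coef f]; one more
   sign turns [f(c) - y] into [y - f(c)]. *)
pose b := (-1) ^+ d.+1 * (lead_coef f)^-1.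
have b_neq0 : b != 0.
  by rewrite mulf_neq0 ?expf_neq0 ?oppr_eq0 ?oner_eq0 ?invr_eq0 ?lead_coef_eq0.
pose P c : {poly k} := b *: ('X - (f.[c])%:P).
have size_P c : size (P c) = 2%N by rewrite size_scale ?size_XsubC.
have prod_eP c : \prod_i (e (s, i) - kap c) = (P c)^k.[e0 s].
  rewrite map_polyZ rmorphB /= map_polyX map_polyC hornerZ hornerXsubC.
  rewrite (eq_bigr (fun i => -1 * (kap c - e (s, i)))) => [|i _]; last first.
    by rewrite mulN1r opprB.
  rewrite big_split /= prod_f prodr_const card_ord rmorphM fmorphV /= -/a.
  by rewrite rmorph_sign exprSr mulrN1 -!mulrA mulNr -mulrN -mulrN opprB.
have [r def_h] := closed_field_poly_normal h.
have lhs : \prod_i u (s, i) = (lead_coef h ^+ d *: \prod_(c <- r) P c)^k.[e0 s].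
  rewrite map_polyZ hornerZ rmorph_prod horner_prod rmorphXn /=.
  rewrite -(eq_bigr _ (fun c _ => prod_eP c)) exchange_big /=.
  rewrite -[X in _ ^+ X](card_ord d) -prodr_const -big_split /=.
  apply: eq_bigr => i _; rewrite hP {1}def_h map_polyZ hornerZ rmorph_prod horner_prod.
  congr (_ * _); apply: eq_bigr => c _.
  by rewrite rmorphB /= map_polyX map_polyC hornerXsubC.
(* Each [e (s, j)] occurs in [u (s, i)] for exactly [m] values of [i], so this is the [m]-th power
   of the product over the fiber. *)
have rhs : \prod_i u (s, i) = (P 0 ^+ m)^k.[e0 s].
  rewrite rmorphXn horner_exp -prod_eP rmorph0.
  transitivity (\prod_i \prod_(j | (s, j) \in C (s, i)) e (s, j)).
    apply: eq_bigr => i _.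
    rewrite /u (reindex_onto (pair s) snd) => [|l /tperm_class_sibling].
      by apply: eq_bigl => j; rewrite eqxx andbT.
    by case: l => s' j /= ->.
  rewrite (exchange_big_dep xpredT) //= -prodrXl; apply: eq_bigr => j _.
  by rewrite subr0 prodr_const card_class_fiber (card_tperm_class _ (s, j0)).
have h_neq0 : h != 0.
  apply/eqP=> h0; have /eqP := hP (s, j0); rewrite h0 rmorph0 horner0.
  apply/negP/prodf_neq0 => l _; apply/eqP => e_0.
  have /eqP : ('X : {poly k}) = 0.
    by apply: (transc_root (eF l)); rewrite map_polyX hornerX.
  by rewrite polyX_eq0.
(* [e0 s] is transcendental, so the polynomials themselves agree; each [P c] has degree 1, so the
   degrees are [deg h] and [m]. *)
have : lead_coef h ^+ d *: \prod_(c <- r) P c = P 0 ^+ m.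
  apply/eqP; rewrite -subr_eq0; apply/eqP/(transc_root (e0F s)).
  by rewrite rmorphB hornerD hornerN -lhs -rhs subrr.
move/(congr1 (fun p : {poly k} => (size p).-1)).
rewrite size_scale ?expf_neq0 ?lead_coef_eq0 // size_exp size_P mul1n => <-.
rewrite {1}def_h size_scale ?lead_coef_eq0 // size_prod_XsubC; congr _.+1.
elim: r {def_h lhs} => [|c r IHr]; first by rewrite big_nil size_poly1.
have prod_neq0 : \prod_(c <- r) P c != 0.
  by rewrite prodf_seq_neq0; apply/allP => c' _; rewrite -size_poly_gt0 size_P.
rewrite big_cons size_mul ?size_P -?size_poly_gt0 ?size_P //.
  by rewrite /= IHr prednK ?size_poly_gt0.
by rewrite size_poly_gt0.
Qed.

Lemma sibling_tperm s i j :
  (exists l0 l1, l0 != l1 /\ tperm l0 l1 \in G) -> tperm (s, i) (s, j) \in G.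
Proof.
case=> l0 [l1 [l0_l1 l01G]].
have [h hP] := class_prod_poly l0.
have size_h := size_class_prod_poly _ hP.
have class_gt1 : (1 < #|C l0|)%N.
  have : [set l0; l1] \subset C l0.
    by rewrite subUset !sub1set tperm_class_refl mem_tperm_class.
  by move/subset_leq_card; rewrite cards2 l0_l1.
have h_gt2 : (2 < size h)%N by rewrite (size_h l0).
have [g def_f] : exists g, f = g \Po h.
  apply: (@poly_decomposition _ _ kap _ _ (e0 l0.1) (u l0) (map e (enum (C l0)))).
  - exact: ltnW.
  - move=> Q; rewrite hP -horner_comp -map_comp_poly.
    move=> /(transc_root (eF l0))/eqP.
    by rewrite comp_poly_eq0 1?ltnW // => /eqP.
  - by rewrite map_inj_uniq ?enum_uniq.
  - by rewrite size_map -cardE (size_h l0).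
  move=> _ /mapP[l + ->]; rewrite mem_enum => lC.
  by rewrite fe (tperm_class_sibling lC) -hP /u (tperm_class_trans lC).
(* As [deg h >= 2], [g] has degree at most 1, so [deg h], the size of a class, reaches [d]: the
   class fills its fiber. *)
have [size_g|] := f_indec def_f; last by rewrite leqNgt h_gt2.
have le_d : (d <= #|[pred j' | (s, i) \in C (s, j')]|)%N.
  have def_d : d = ((size g).-1 * (size h).-1)%N.
    by rewrite -size_comp_poly -def_f size_f.
  rewrite card_class_fiber (card_tperm_class _ l0) [leqLHS]def_d (size_h l0) /=.
  by case: (size g) size_g => [|[|[|]]] // _; rewrite ?mul0n ?mul1n.
have : [pred j' | (s, i) \in C (s, j')] =i predT.
  apply/subset_cardP; last exact/subsetP.
  by apply/eqP; rewrite eqn_leq max_card card_ord.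
by move/(_ j); rewrite !inE tpermC => ->.
Qed.

End Fibers.

(** * The tree of iterated preimages of [tau] and its Galois group *)

Section Tower.

Variables (d N : nat) (f : {poly k}) (rs : seq L).
Hypotheses (d_ge2 : (2 <= d)%N) (d2_p2 : ~ (d = 2%N /\ 2%N \in [pchar k])).
Hypothesis fH : H_set d N f.
Hypothesis splits : (poly_iter f N)^k - tau%:P %= \prod_(z <- rs) ('X - z%:P).
Hypothesis defE : <<1 & rs>>%VS = E :> {vspace L}.

Local Notation it n := (poly_iter f n).

Let size_f : size f = d.+1. Proof. by case: fH. Qed.

Let size_it n : size (it n) = (d ^ n).+1.
Proof. exact: size_poly_iter (ltnW d_ge2) size_f. Qed.

Let size_it_gt1 n : (1 < size (it n))%N.
Proof. by rewrite size_it ltnS expn_gt0 ltnW. Qed.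

(** [f^m - y] is [(X - y) \Po f^m], which divides [(f^n - tau) \Po f^m = f^N - tau]. *)
Lemma iter_divisor_root n m y (q : {poly L}) :
  (n + m)%N = N -> (it n)^k.[y] = tau -> q %| (it m)^k - y%:P ->
  (1 < size q)%N -> exists2 z, z \in rs & root q z.
Proof.
move=> nm ny q_dvd size_q.
have : q %| \prod_(z <- rs) ('X - z%:P).
  rewrite -(eqp_dvdr _ splits); apply: dvdp_trans q_dvd _.
  rewrite -nm poly_iterD map_comp_poly -(comp_polyC tau (it m)^k) -comp_polyB.
  rewrite -[X in X - y%:P]comp_polyX -(comp_polyC y (it m)^k) -comp_polyB.
  by apply: dvdp_comp_poly; rewrite dvdp_XsubCl rootE !hornerE ny subrr.
case/dvdp_prod_XsubC=> bs q_eq.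
have : (1 < size (\prod_(z <- mask bs rs) ('X - z%:P))%R)%N.
  by rewrite -(eqp_size q_eq).
rewrite size_prod_XsubC ltnS; case def_m: (mask bs rs) => [|z s] // _.
have z_m : z \in mask bs rs by rewrite def_m mem_head.
by exists z; [apply: mem_mask z_m | rewrite (eqp_root q_eq) root_prod_XsubC].
Qed.

Lemma iter_root_mem n z : (n <= N)%N -> (it n)^k.[z] = tau -> z \in E.
Proof.
move=> le_nN nz.
have [|y y_rs] := iter_divisor_root (subnKC le_nN) nz (dvdpp _).
  rewrite size_polyDl ?size_map_poly // size_polyN.
  by rewrite (leq_ltn_trans (size_polyC_leq1 _)).
rewrite rootE !hornerE subr_eq0 => /eqP <-; apply: rpred_horner.
  by apply/polyOverP => i; rewrite coef_map mem_const.
have := seqv_sub_adjoin 1%AS y_rs; rewrite defE; exact.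
Qed.

Lemma iter_root_fiber n y : (n < N)%N -> (it n)^k.[y] = tau ->
  exists g : 'I_d -> L,
    [/\ injective g, forall i, f^k.[g i] = y
      & forall z, f^k.[z] = y -> exists i, z = g i].
Proof.
move=> lt_nN ny; pose p := f^k - y%:P.
have size_y : (size (- y%:P : {poly L})%R < size f^k)%N.
  rewrite size_polyN size_map_poly size_f.
  by rewrite (leq_ltn_trans (size_polyC_leq1 _)) // ltnS ltnW.
have size_p : size p = d.+1 by rewrite size_polyDl // size_map_poly.
have p_neq0 : p != 0 by rewrite -size_poly_gt0 size_p.
have fz z : root p z -> f^k.[z] = y.
  by rewrite rootE hornerD hornerN hornerC subr_eq0 => /eqP.
have p_root q : q %| p -> (1 < size q)%N -> exists z, root q z.
  (* A root of [q] is found as [f^m(z)]: [q \Po f^m] divides [f^(m+1) - y], whose factors have roots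
     in [rs] since [n + m + 1 = N]. *)
  move=> q_p size_q; pose m := (N - n.+1)%N.
  have [|||z _] := @iter_divisor_root n m.+1 y (q \Po (it m)^k) _ ny.
  - by rewrite /m; lia.
  - rewrite /= map_comp_poly -(comp_polyC y (it m)^k) -comp_polyB.
    exact: dvdp_comp_poly.
  - rewrite -[size _]prednK ?size_poly_gt0; last first.
      by rewrite comp_poly_eq0 ?size_map_poly // -size_poly_gt0 ltnW.
    rewrite size_comp_poly size_map_poly size_it ltnS muln_gt0 ltn_predRL size_q.
    by rewrite /= expn_gt0 ltnW.
  by rewrite rootE horner_comp => qz; exists (it m)^k.[z].
have [s def_p] := poly_splits p_neq0 p_root.
have p_s : p %= \prod_(z <- s) ('X - z%:P).
  by rewrite {1}def_p eqp_scale ?lead_coef_eq0.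
have s_uniq : uniq s.
  rewrite -separable_prod_XsubC -(eqp_separable p_s).
  apply: separable_sub_transc p_root; first exact: H_set_deriv_neq0 fH.
  exact: transc_root ny.
have size_s : size s = d.
  by have := eqp_size p_s; rewrite size_p size_prod_XsubC => -[].
have root_s z : root p z = (z \in s) by rewrite (eqp_root p_s) root_prod_XsubC.
exists (fun i => s`_i); split=> [i j /eqP|i|z pz].
- by rewrite nth_uniq ?size_s // => /eqP/ord_inj.
- by apply: fz; rewrite root_s mem_nth ?size_s.
have z_s : z \in s by rewrite -root_s rootE hornerD hornerN hornerC pz subrr.
have lt_z : (index z s < d)%N by rewrite -size_s index_mem.
by exists (Ordinal lt_z); rewrite nth_index.
Qed.

Definition fiber (y : L) : 'I_d -> L :=
  epsilon (inhabits (fun=> 0)) (fun g : 'I_d -> L =>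
    [/\ injective g, forall i, f^k.[g i] = y
      & forall z, f^k.[z] = y -> exists i, z = g i]).

(** Labels the preimages of [tau] so that, up to level [N], [f] becomes the projection
    [(l, i) |-> l]. *)
Fixpoint iter_root n : leaves d n -> L :=
  match n return leaves d n -> L with
  | 0 => fun=> tau
  | n'.+1 => fun l => fiber (@iter_root n' l.1) l.2
  end.
Arguments iter_root : clear implicits.

Lemma fiber_iter_rootP n l : (n < N)%N -> (it n)^k.[iter_root n l] = tau ->
  [/\ injective (fiber (iter_root n l)),
      forall i, f^k.[iter_root n.+1 (l, i)] = iter_root n l
    & forall z, f^k.[z] = iter_root n l -> exists i, z = iter_root n.+1 (l, i)].
Proof.
by move=> lt_nN rl; apply: (epsilon_spec _ _ (iter_root_fiber lt_nN rl)).
Qed.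

Lemma iter_rootP n : (n <= N)%N ->
  [/\ injective (iter_root n), forall l, (it n)^k.[iter_root n l] = tau
    & forall z, (it n)^k.[z] = tau -> exists l : leaves d n, z = iter_root n l].
Proof.
elim: n => [|n IHn] lt_nN.
  split=> [[] []|l|z] //; first by rewrite map_polyX hornerX.
  by rewrite map_polyX hornerX => ->; exists tt.
have [r_inj rP r_onto] := IHn (ltnW lt_nN).
have fP l := fiber_iter_rootP lt_nN (rP l).
split=> [[l i] [l' i'] eq_r|[l i]|z].
- have [inj_l fl _] := fP l; have [_ fl' _] := fP l'.
  have l_l' : l = l' by apply: r_inj; rewrite -(fl i) -(fl' i') eq_r.
  by rewrite -l_l' in eq_r *; congr (_, _); apply: inj_l.
- by have [_ fl _] := fP l; rewrite poly_iterSr map_comp_poly horner_comp fl.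
rewrite poly_iterSr map_comp_poly horner_comp => /r_onto[l fz].
by have [_ _ /(_ z fz)[i ->]] := fP l; exists (l, i).
Qed.

Let root_inj n (le_nN : (n <= N)%N) : injective (iter_root n).
Proof. by case: (iter_rootP le_nN). Qed.

Let root_iter n (le_nN : (n <= N)%N) l : (it n)^k.[iter_root n l] = tau.
Proof. by case: (iter_rootP le_nN). Qed.

Let root_onto n (le_nN : (n <= N)%N) z :
  (it n)^k.[z] = tau -> exists l, z = iter_root n l.
Proof. by case: (iter_rootP le_nN) => _ _; apply. Qed.

Let root_E n (le_nN : (n <= N)%N) l : iter_root n l \in E.
Proof. exact: iter_root_mem le_nN (root_iter le_nN l). Qed.

Local Notation Gn le_nN := (root_group (root_inj le_nN) (root_E le_nN)
  (root_iter le_nN) (@root_onto _ le_nN)).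

Lemma iter_rootS n x : (n < N)%N ->
  f^k.[iter_root n.+1 x] = iter_root n x.1.
Proof.
case: x => l i lt_nN.
by case: (fiber_iter_rootP lt_nN (root_iter (ltnW lt_nN) l)).
Qed.

Lemma card_leaves n : #|{: leaves d n}| = (d ^ n)%N.
Proof.
by elim: n => [|n IHn]; rewrite ?card_unit // card_prod IHn card_ord expnSr.
Qed.

Lemma iter_root_sibling_tperm n (lt_nN : (n < N)%N) l i j :
  tperm (l, i) (l, j) \in Gn lt_nN.
Proof.
have HnS := H_set_le fH lt_nN.
apply: (sibling_tperm (f := f) (F1 := it n) (e0 := iter_root n)) => //.
- exact: (H_set_indecomposable d_ge2 (ltn0Sn n) HnS).
- exact: root_inj (ltnW lt_nN).
- exact: root_iter (ltnW lt_nN).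
- by move=> x; apply: iter_rootS.
have [w w_crit] := H_set_crit d_ge2 d2_p2 fH.
apply: (@simple_critical_point_tperm _ _ _ _ _ _ _ _ _ w) => //.
- by rewrite size_it -card_leaves.
- exact: deriv_poly_iter_root.
- by rewrite horner_poly_iter; apply: (@H_set_iter_cube _ d n.+1 f).
move=> v v_crit; rewrite !horner_poly_iter.
exact: (H_set_iter_crit HnS w_crit v_crit).
Qed.

Lemma root_group_fst n (lt_nN : (n < N)%N) (s : gal_of E)
    (p : {perm leaves d n.+1}) (q : {perm leaves d n}) :
  (forall x, iter_root n.+1 (p x) = s (iter_root n.+1 x)) ->
  (forall l, iter_root n (q l) = s (iter_root n l)) ->
  forall x, (p x).1 = q x.1.
Proof.
move=> ps qs x; apply: (root_inj (ltnW lt_nN)).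
by rewrite -!iter_rootS // qs ps -iter_rootS // gal_horner.
Qed.

(** By induction on the level. Given [p] over [q], an automorphism inducing [q] acts one level up as
    some [r], and [p * r^-1] preserves each fiber, so transpositions of siblings generate it.
    Conversely, automorphisms commute with [f], hence respect the tree. *)
Lemma wreath_pow_root_group n (le_nN : (n <= N)%N) :
  wreath_pow d n = Gn le_nN :> {set {perm leaves d n}}.
Proof.
apply/setP=> p; apply/idP/idP.
  elim: n le_nN p => [|n IHn] lt_nN p.
    move=> _; suff -> : p = 1%g by apply: group1.
    by apply/permP=> x; rewrite perm1; case: (p x); case: x.
  rewrite inE => /exists_inP[q q_wr /existsP[t /forallP pE]].
  have /root_groupP[s sG qs] := IHn (ltnW lt_nN) q q_wr.
  pose r := root_perm (root_inj lt_nN) (root_iter lt_nN) (@root_onto _ lt_nN) s.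
  have rE x : iter_root n.+1 (r x) = s (iter_root n.+1 x) by apply: root_permE.
  have rG : r \in Gn lt_nN by apply/root_groupP; exists s.
  rewrite -(groupMr _ (groupVr rG)).
  apply: fiber_perm_mem => [l i j|x]; first exact: iter_root_sibling_tperm.
  rewrite permM; apply: (@perm_inj _ q).
  by rewrite -(root_group_fst lt_nN rE qs) permKV (eqP (pE x)).
elim: n le_nN p => [|n IHn] lt_nN p; first by rewrite inE.
case/root_groupP=> s sG ps.
pose q := root_perm (root_inj (ltnW lt_nN)) (root_iter (ltnW lt_nN))
  (@root_onto _ (ltnW lt_nN)) s.
have qs l : iter_root n (q l) = s (iter_root n l) by apply: root_permE.
have pq := root_group_fst lt_nN ps qs.
rewrite inE; apply/exists_inP; exists q.
  by apply: (IHn (ltnW lt_nN)); apply/root_groupP; exists s.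
have p_inj l : injective (fun i => (p (l, i)).2).
  move=> i j eq_p; suff /(@perm_inj _ p)[] : p (l, i) = p (l, j) by [].
  by rewrite [LHS]surjective_pairing [RHS]surjective_pairing eq_p !pq.
apply/existsP; exists [ffun l => perm (@p_inj l)]; apply/forallP => -[l i].
by apply/eqP; rewrite [LHS]surjective_pairing pq ffunE (permE (@p_inj _)).
Qed.

(** The action on the roots is faithful because [rs] generates [E]: if [s] and [t] act alike,
    [s * t^-1] fixes [rs], hence [E]. *)
Lemma gal_isog_wreath_pow : ('Gal(E / 1%AS) \isog wreath_pow d N)%g.
Proof.
rewrite (wreath_pow_root_group (leqnn N)); apply: sub_isog => //.
apply/injmP=> s t sG tG /= eq_st; apply/eqP/gal_eqP => z zE.
suff /subvP/(_ _ zE) : (E <= fixedField [set (s * t^-1)%g])%VS.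
  case/mem_fixedFieldP=> _ /(_ _ (set11 _)); rewrite galM // => {2}<-.
  by rewrite -galM ?memv_gal // mulVg gal_id.
rewrite -[X in (X <= _)%VS]defE; apply/Fadjoin_seqP; split; first exact: sub1v.
move=> y y_rs; have y_root : (it N)^k.[y] = tau.
  apply/eqP; rewrite -subr_eq0 -[tau](hornerC _ y) -hornerN -hornerD -rootE.
  by rewrite (eqp_root splits) root_prod_XsubC.
have [l ->] := root_onto (leqnn N) y_root.
apply/fixedFieldP=> [|u /set1P->]; first exact: root_E.
rewrite galM ?root_E // -(root_permE (root_inj (leqnn N)) (root_iter (leqnn N))
  (@root_onto _ (leqnn N))) eq_st root_permE.
by rewrite -galM ?root_E // mulgV gal_id.
Qed.

End Tower.

End GaloisAction.

(** * Extensions of the rational function field *)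

Section RationalFunctions.

Variables (k : closedFieldType) (L : splittingFieldType (ratfun k)).

Lemma ratfun_fraction (r : ratfun k) :
  exists A Q : {poly k}, Q != 0 /\ r * tofrac Q = tofrac A.
Proof.
elim/quotW: r => x; exists \n_x, \d_x; rewrite denom_ratioP; split=> //.
rewrite !piE; apply/eqmodP.
rewrite /= FracField.equivfE.
rewrite /FracField.mulf !numden_Ratio ?mulf_neq0 ?oner_neq0 ?denom_ratioP //.
by rewrite !mulr1 mulrC.
Qed.

Let kap : {rmorphism k -> L} := in_alg L \o (@tofrac _ \o polyC).
Let tau : L := (t_rf k)%:A.

Lemma horner_t_rf (Q : {poly k}) : (map_poly kap Q).[tau] = (tofrac Q)%:A.
Proof.
elim/poly_ind: Q => [|Q c IHQ]; first by rewrite !rmorph0 horner0 scale0r.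
rewrite rmorphD rmorphM /= map_polyX map_polyC hornerMXaddC IHQ.
by rewrite tofracD tofracM scalerDl -scalerAl mul1r scalerA.
Qed.

Lemma transc_t_rf : transc kap tau.
Proof.
move=> Q /eqP; rewrite horner_t_rf scaler_eq0 oner_eq0 orbF.
by rewrite tofrac_eq0 => /eqP.
Qed.

Lemma map_iter_minus_t (f : {poly k}) N :
  map_poly (in_alg L) (iter_minus_t f N) =
  map_poly kap (poly_iter f N) - tau%:P.
Proof. by rewrite rmorphB /= map_polyC -map_poly_comp. Qed.

End RationalFunctions.

Theorem theorem3p7 (k : closedFieldType) (d N : nat) (f : {poly k})
  (L : splittingFieldType (ratfun k)) (E : {subfield L}) :
  (2 <= d)%N -> (1 <= N)%N -> ~ (d = 2%N /\ 2%N \in [pchar k]) ->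
  H_set d N f ->
  splittingFieldFor 1%AS (map_poly (in_alg L) (iter_minus_t f N)) E ->
  ('Gal(E / 1%AS) \isog wreath_pow d N)%g.
Proof.
move=> d_ge2 N_ge1 d2_p2 fH splitE.
have [rs] := splitE; rewrite map_iter_minus_t => splits defE.
have size_f : size f = d.+1 by case: fH.
apply: (gal_isog_wreath_pow _ _ _ (@transc_t_rf k L) _ d_ge2 d2_p2 fH splits defE).
- apply/splitting_galoisField.
  exists (map_poly (in_alg L) (iter_minus_t f N)); split=> //.
    by apply/polyOver1P; exists (iter_minus_t f N).
  rewrite map_iter_minus_t; apply: separable_sub_transc (@transc_t_rf k L) _.
    by apply: deriv_poly_iter_neq0 (H_set_deriv_neq0 fH); rewrite size_f ltnS ltnW.
  move=> q; rewrite (eqp_dvdr _ splits) => /dvdp_prod_XsubC[bs q_eq].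
  rewrite (eqp_size q_eq) size_prod_XsubC; case def_m: (mask bs rs) => [|z s] // _.
  by exists z; rewrite (eqp_root q_eq) root_prod_XsubC def_m mem_head.
- by move=> c; exists (const_rf c).
- by exists (t_rf k).
move=> r; have [A [Q [Q_neq0 rQ]]] := ratfun_fraction r.
by exists A, Q; rewrite !horner_t_rf -scalerAl mul1r scalerA rQ.
Qed.
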